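(* Let $(m,n)$ be a coprime pair of positive integers with $m=kn\pm1$, $k\ge 1$. For every SW-sequence $\sigma\in\mathcal{D}_{m,n}$, the recursive procedure FussiPhi (described in the context) outputs a rank sequence $\mathfrak r$ compatible with $\sigma$.
   Context: An $(m,n)$-Dyck path is a lattice path from $(0,0)$ to $(m,n)$ with unit north steps $u$ and unit east steps $d$ that never goes below $y=\frac nm x$; $\mathcal{D}_{m,n}$ is the set of them, written as words in $u,d$. An SW-sequence is a word $\sigma=(\sigma_1,\dots,\sigma_{m+n})$ with $n$ letters $S$ and $m$ letters $W$; $\sigma\in\mathcal{D}_{m,n}$ means that replacing $S$ by $u$ and $W$ by $d$ gives an $(m,n)$-Dyck path. The $i$-th $S$ from the left is labelled $S_i$, the $j$-th $W$ is labelled $W_j$, and $\sigma^{-1}(S_i)$, $\sigma^{-1}(W_j)$ are their positions in $\sigma$. For a set $R\ni0$ of $m+n$ nonnegative integers with increasing rearrangement $\mathfrak r=\mathrm{sort}(R)=(\mathfrak r_1<\dots<\mathfrak r_{m+n})$, put $\mathfrak r(S_i)=\mathfrak r_{\sigma^{-1}(S_i)}$ and $\mathfrak r(W_j)=\mathfrak r_{\sigma^{-1}(W_j)}$. The sequence $\mathfrak r$ is compatible with $\sigma$ if $\mathfrak r(S_i)+m\in R$ for $1\le i\le n$ and $\mathfrak r(W_j)-n\in R$ for $1\le j\le m$. Procedure FussiPhi, on input $\sigma\in\mathcal{D}_{m,n}$: (1) If $\sigma=S^nW^m$, output $\mathfrak r=(0,1,\dots,m+n-1)$ and stop. (2) Let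 $f_0=1$ and $f_i=\sigma^{-1}(W_{f_{i-1}})$ for $i\ge1$. Put $s=f_1=\sigma^{-1}(W_1)$. Put $\delta=f_{k+1}$ if $m=kn+1$, and $\delta=\sigma^{-1}(W_{f_k-1})-1$ if $m=kn-1$. (3) Let $\sigma^L$ be obtained from $\sigma$ by inserting a $W$ immediately after $\sigma_\delta$ and then removing the letter $\sigma_s=W$. Recursively compute the output $\mathfrak r^L=(\mathfrak r^L_1,\dots,\mathfrak r^L_{m+n})$ of the procedure on $\sigma^L$. Put $t=n-\mathfrak r^L_{s-1}$ and output $$\mathfrak r=\mathrm{sort}\Big(\big(\{\mathfrak r^L_1+t,\dots,\mathfrak r^L_{m+n}+t\}\setminus\{m+n\}\big)\cup\{0\}\Big).$$ *)

(* Defs.v *)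
From mathcomp Require Import all_boot all_order all_algebra.

Set Implicit Arguments.
Unset Strict Implicit.
Unset Printing Implicit Defensive.

Import Order.TTheory GRing.Theory Num.Theory.

(* Words in S and W: S is [true] (a unit north step), W is [false] (a unit
   east step). *)
Definition word := seq bool.
Notation letS := true (only parsing).
Notation letW := false (only parsing).

(* The lattice point reached after p steps is
   (number of W's, number of S's) in [take p sg]; it lies on or above
   y = (n / m) x iff n x <= m y. *)
Definition dyck (m n : nat) (sg : word) : Prop :=
  [/\ count_mem letS sg = n, count_mem letW sg = m &
      forall p, p <= size sg ->
        n * count_mem letW (take p sg) <= m * count_mem letS (take p sg)].

(* [pos c sg j] is the position of the j-th letter c of sg. Both j and the
   position are counted from 1; the value is 0 if there is no such letter,
   in particular if j = 0. *)
Definition pos (c : bool) (sg : word) (j : nat) : nat :=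
  nth 0 (0 :: [seq p <- iota 1 (size sg) | nth c sg p.-1 == c]) j.

(* The p-th entry of r, counted from 1. *)
Definition entry (r : seq int) (p : nat) : int := nth 0%R r p.-1.

(* r is the increasing rearrangement of a set of m + n nonnegative integers
   containing 0; the set itself is the membership predicate of r. *)
Definition rank_seq (m n : nat) (r : seq int) : Prop :=
  [/\ size r = m + n, sorted <%R r, all (fun x => 0 <= x)%R r & 0%R \in r].

Definition compatible (m n : nat) (sg : word) (r : seq int) : Prop :=
  (forall i, 1 <= i <= n -> (entry r (pos letS sg i) + m%:Z)%R \in r) /\
  (forall j, 1 <= j <= m -> (entry r (pos letW sg j) - n%:Z)%R \in r).

Definition initial_word (m n : nat) : word := nseq n letS ++ nseq m letW.

Definition fussi_f (sg : word) (i : nat) : nat := iter i (pos letW sg) 1.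

Definition fussi_s (sg : word) : nat := fussi_f sg 1.

(* The second branch is meant for m = k n - 1. If one of the positions
   involved does not exist, the value is 0. *)
Definition fussi_delta (m n k : nat) (sg : word) : nat :=
  if m == k * n + 1 then fussi_f sg k.+1
  else (pos letW sg (fussi_f sg k - 1) - 1).

Definition insert_after (d : nat) (c : bool) (w : word) : word :=
  take d w ++ c :: drop d w.

Definition remove_at (p : nat) (w : word) : word := take p.-1 w ++ drop p w.

(* When s <= delta the insertion does not move the s-th letter, so that the
   letter removed is the s-th letter of sg. *)
Definition fussi_left (m n k : nat) (sg : word) : word :=
  remove_at (fussi_s sg) (insert_after (fussi_delta m n k sg) letW sg).

(* The output computed from the output rL of the recursive call. *)
Definition fussi_out (m n : nat) (s : nat) (rL : seq int) : seq int :=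
  let t := (n%:Z - entry rL s.-1)%R in
  sort <=%R
    (undup (0%R :: [seq y <- [seq (x + t)%R | x <- rL] | y != Posz (m + n)])).

(* [FussiPhi m n k sg r]: run on input sg, the procedure terminates with
   output r. The derivations are the finite runs. Every word on which the
   procedure is called is required to be an (m,n)-Dyck path, and
   1 < s <= delta excludes steps in which a position used by the procedure
   does not exist, so an undefined step yields no output at all. *)
Inductive FussiPhi (m n k : nat) : word -> seq int -> Prop :=
| FussiPhi_stop :
    dyck m n (initial_word m n) ->
    FussiPhi m n k (initial_word m n) [seq Posz i | i <- iota 0 (m + n)]
| FussiPhi_step (sg : word) (rL : seq int) :
    dyck m n sg ->
    sg <> initial_word m n ->
    1 < fussi_s sg <= fussi_delta m n k sg ->
    FussiPhi m n k (fussi_left m n k sg) rL ->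
    FussiPhi m n k sg (fussi_out m n (fussi_s sg) rL).

(* Main.v *)
Require Import Defs.
From mathcomp Require Import all_boot all_order all_algebra zify.

Set Implicit Arguments.
Unset Strict Implicit.
Unset Printing Implicit Defensive.

Import Order.TTheory GRing.Theory Num.Theory.

(** Write sigma = S^a W B C, where the removed W is at position s = a + 1 and
    delta = a + 1 + |B|; then sigma^L = S^a B W C. A sequence compatible with
    sigma^L carries a step map x |-> x + m or x - n on its set, which by
    coprimality is a bijection. Hence every element smaller than m is reached by
    a W step, and the j-th smallest such element r_j is reached from r(W_j), so
    that r(W_j) = r_j + n. Iterating this along the f_i gives
    r^L_(f_i - 1) = r^L_(s-1) + (i - 1) n, and finally
    r^L_delta = r^L_(s-1) + m. After the shift by t, position s - 1 of r^L carries n and position delta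
    carries m + n, so the path n -> n + m -> m is rerouted through
    n -> 0 -> m; this exchanges an S and a W and yields sigma. The Dyck
    condition forces B to contain an S, so the recursion decreases the number of
    pairs of a W preceding an S. *)

(** * Positions of letters in a word *)

Lemma size_pos_seq (c : bool) (w : word) :
  size [seq p <- iota 1 (size w) | nth c w p.-1 == c] = count_mem c w.
Proof.
rewrite size_filter -[in RHS](mkseq_nth c w) /mkseq count_map (iotaDl 1 0).
by rewrite count_map; apply: eq_count => i.
Qed.

Lemma pos_seq_cat (c : bool) (w1 w2 : word) :
  [seq p <- iota 1 (size (w1 ++ w2)) | nth c (w1 ++ w2) p.-1 == c] =
  [seq p <- iota 1 (size w1) | nth c w1 p.-1 == c] ++
  [seq size w1 + p | p <- [seq p <- iota 1 (size w2) | nth c w2 p.-1 == c]].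
Proof.
rewrite size_cat iotaD filter_cat addnC; congr cat.
  apply: eq_in_filter => p; rewrite mem_iota => /andP[p0 pw].
  by rewrite nth_cat; case: ltnP => //; lia.
rewrite iotaDl filter_map; congr map; apply: eq_in_filter => p.
rewrite mem_iota /= => /andP[p0 _].
by rewrite nth_cat; case: ltnP => [|_]; [lia | congr (nth _ _ _ == _); lia].
Qed.

Lemma pos_catl (c : bool) (w1 w2 : word) j :
  j <= count_mem c w1 -> pos c (w1 ++ w2) j = pos c w1 j.
Proof.
rewrite /pos pos_seq_cat; case: j => // j jw /=.
by rewrite nth_cat size_pos_seq jw.
Qed.

Lemma pos_catr (c : bool) (w1 w2 : word) j :
  count_mem c w1 < j <= count_mem c (w1 ++ w2) ->
  pos c (w1 ++ w2) j = size w1 + pos c w2 (j - count_mem c w1).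
Proof.
rewrite /pos pos_seq_cat; case: j => [|j] /andP[] //; rewrite ltnS count_cat => jw1 jw2.
rewrite subSn // /= nth_cat size_pos_seq ltnNge jw1 /=.
by rewrite (nth_map 0) // size_pos_seq ltn_subLR.
Qed.

Lemma pos_cat_cons (c : bool) (u v : word) :
  pos c (u ++ c :: v) (count_mem c u).+1 = (size u).+1.
Proof.
rewrite pos_catr ?count_cat /= ?eqxx; last by lia.
by rewrite subSnn /pos /= eqxx /= addn1.
Qed.

Lemma count_split (c : bool) (w : word) j :
  j < count_mem c w -> exists u v, w = u ++ c :: v /\ count_mem c u = j.
Proof.
elim: w j => // x w IH [|j] /=; case: (eqVneq x c) => [->|xc] /=.
- by exists [::], w.
- by move=> /IH[u [v [-> <-]]]; exists (x :: u), v; rewrite /= (negPf xc).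
- by rewrite add1n ltnS => /IH[u [v [-> <-]]]; exists (c :: u), v; rewrite /= eqxx.
- by move=> /IH[u [v [-> <-]]]; exists (x :: u), v; rewrite /= (negPf xc).
Qed.

Lemma pos_split (c : bool) (w : word) j :
  0 < j <= count_mem c w ->
  exists u v, [/\ w = u ++ c :: v, count_mem c u = j.-1 & pos c w j = (size u).+1].
Proof.
case: j => // j /count_split[u [v [-> <-]]]; exists u, v.
by rewrite pos_cat_cons.
Qed.

Lemma count_letters (w : word) : count_mem letS w + count_mem letW w = size w.
Proof. by elim: w => //= -[] w /=; lia. Qed.

(** * The step map of a compatible sequence *)

Open Scope ring_scope.

Definition shift (m n : nat) (b : bool) : int := if b then m%:Z else - n%:Z.

(** Indexed by positions instead of by the letters of each kind, compatibility becomes a single step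
    map. Positions count from 0 here, while [entry] counts from 1. *)
Definition closed_under (m n : nat) (w : word) (r : seq int) : Prop :=
  forall p, (p < size w)%N -> entry r p.+1 + shift m n (nth letW w p) \in r.

Lemma compatibleP (m n : nat) (w : word) (r : seq int) :
  count_mem letS w = n -> count_mem letW w = m ->
  compatible m n w r <-> closed_under m n w r.
Proof.
move=> wS wW; split=> [[cS cW] p pw|cw].
  have := cat_take_drop p w; rewrite (drop_nth letW pw).
  set b := nth _ _ _ => E.
  have P c : b = c -> pos c w (count_mem c (take p w)).+1 = p.+1.
    by move=> bc; rewrite -[w in pos _ w]E bc pos_cat_cons size_takel // ltnW.
  have Q c : b = c -> (0 < (count_mem c (take p w)).+1 <= count_mem c w)%N.
    by move=> bc; rewrite -[w in (_ <= count_mem _ w)%N]E count_cat /= bc eqxx; lia.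
  case: (boolP b) => bb.
    have := cS _ ltac:(rewrite -wS; exact: (Q letS)).
    by rewrite (P letS) // /shift /=.
  have := cW _ ltac:(rewrite -wW; exact: (Q letW (negbTE bb))).
  by rewrite (P letW) ?(negbTE bb) // /shift.
have P (c : bool) j : (0 < j <= count_mem c w)%N ->
    entry r (pos c w j) + shift m n c \in r.
  move=> /pos_split[u [v [E _ ->]]].
  have uw : (size u < size w)%N by rewrite E size_cat /= -addSnnS leq_addr.
  by have := cw _ uw; rewrite [in nth letW w _]E nth_cat ltnn subnn.
by split=> j jP; [apply: (P letS); rewrite wS | apply: (P letW); rewrite wW].
Qed.

(** A sum over all positions, rather than over a prefix, can be reindexed along a bijection of
    positions. *)
Lemma count_take_ord (w : word) (c : bool) q :
  count_mem c (take q w) =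
  (\sum_(i < size w) ((i < q) && (nth letW w i == c) : nat))%N.
Proof.
elim/last_ind: w => [|w x IH]; first by rewrite big_ord0.
rewrite size_rcons big_ord_recr /= nth_rcons ltnn eqxx -cats1 take_cat.
have -> : (\sum_(i < size w) ((i < q) && (nth letW (w ++ [:: x]) i == c) : nat) =
   count_mem c (take q w))%N.
  by rewrite IH; apply: eq_bigr => i _; rewrite nth_cat ltn_ord.
case: ltnP => qw; first by rewrite (ltnNge _ q) (ltnW qw) /= addn0.
rewrite (@take_oversize _ q w) // count_cat; case: (ltnP (size w) q) => qw'.
  by rewrite take_oversize ?subn_gt0 //= addn0.
by rewrite (_ : q - size w = 0)%N //; lia.
Qed.

Lemma count_ord (w : word) (c : bool) :
  count_mem c w = (\sum_(i < size w) (nth letW w i == c : nat))%N.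
Proof.
rewrite -{1}(take_size w) count_take_ord.
by apply: eq_bigr => i _; rewrite ltn_ord.
Qed.

(* On a smallest nonempty invariant set the step map is onto, so the a letters
   S and b letters W read there satisfy a m = b n; as m and n are coprime, the
   set is everything. *)
Lemma step_bijection (m n : nat) (w : word) (r : seq int) :
  (0 < n)%N -> coprime m n ->
  count_mem letS w = n -> count_mem letW w = m ->
  size r = size w -> closed_under m n w r ->
  exists2 g : 'I_(size w) -> 'I_(size w), injective g &
    forall p, entry r (g p).+1 = entry r p.+1 + shift m n (nth letW w p).
Proof.
move=> n0 co wS wW rw cw.
pose N := size w.
have N0 : (0 < N)%N by rewrite /N -count_letters; lia.
have ix (p : 'I_N) : (index (entry r p.+1 + shift m n (nth letW w p))%R r < N)%N.
  by apply: leq_trans (_ : size r <= N)%N; [rewrite index_mem cw | rewrite rw].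
pose g (p : 'I_N) := Ordinal (ix p).
have gE p : entry r (g p).+1 = entry r p.+1 + shift m n (nth letW w p).
  by rewrite {1}/entry nth_index ?cw.
exists g => //.
pose P (C : {set 'I_N}) := (C != set0) && (g @: C \subset C).
have PT : P setT by rewrite /P subsetT andbT; apply/set0Pn; exists (Ordinal N0).
have [C /minsetP[/andP[C0 gC] Cmin] _] := minset_exists PT.
have gCC : g @: C = C.
  apply: Cmin => //; rewrite /P imset_eq0 C0 /=; exact: imsetS.
have injC : {in C &, injective g} by apply/imset_injP; rewrite gCC.
pose a := (\sum_(p in C) (nth letW w p == letS : nat))%N.
pose b := (\sum_(p in C) (nth letW w p == letW : nat))%N.
have ab : (a + b = #|C|)%N.
  rewrite -big_split /= -sum1_card; apply: eq_bigr => p _.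
  by case: (nth _ _ _).
have an : (a <= n)%N.
  rewrite -wS count_ord /a big_mkcond /=.
  by apply: leq_sum => p _; case: (p \in C).
(* As [g] permutes C, the entries over C have the same sum before and after a step, so the shifts
   cancel. *)
have sumC : \sum_(p in C) shift m n (nth letW w p) = 0.
  apply: (@addrI _ (\sum_(p in C) entry r p.+1)); rewrite addr0 -big_split /=.
  rewrite -{2}gCC big_imset //=; by apply: eq_bigr => p _; rewrite gE.
have amb : (a * m = b * n)%N.
  suff : (a * m)%N%:Z - (b * n)%N%:Z = 0 by lia.
  rewrite -sumC /a /b !big_distrl /= !(big_morph Posz PoszD (erefl _)) -sumrB.
  by apply: eq_bigr => p _; rewrite /shift; case: (nth _ _ _) => /=; lia.
have nda : (n %| a)%N.
  by rewrite -(@Gauss_dvdl _ _ m) 1?coprime_sym // amb dvdn_mull.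
have CT : C = setT.
  apply/eqP; rewrite eqEcard subsetT cardsT card_ord /= -ab /N -count_letters wS wW.
  case: (posnP a) => [a0|a0].
    by move: C0; rewrite -card_gt0 -ab; move: amb; rewrite a0; nia.
  have -> : a = n by apply/eqP; rewrite eqn_leq an dvdn_leq.
  have := amb; have := dvdn_leq a0 nda; nia.
by move=> p q; apply: injC; rewrite CT inE.
Qed.

Lemma entryS_lt (r : seq int) i j : sorted <%R r -> (i < size r)%N ->
  (j < size r)%N -> (entry r i.+1 < entry r j.+1) = (i < j)%N.
Proof. by move=> sr ir jr; apply: lt_sorted_ltn_nth. Qed.

(* No element below [entry r 1 + m] ends an S step, so the j-th smallest of
   these elements is reached from the j-th W. *)
Lemma rank_posW (m n : nat) (w : word) (r : seq int) (j : nat) :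
  (0 < n)%N -> coprime m n ->
  count_mem letS w = n -> count_mem letW w = m ->
  size r = size w -> sorted <%R r -> closed_under m n w r ->
  (0 < j <= size w)%N -> entry r j < entry r 1 + m%:Z ->
  [/\ (j <= m)%N, (0 < pos letW w j <= size w)%N &
      entry r (pos letW w j) = entry r j + n%:Z].
Proof.
move=> n0 co wS wW rw sr cw; case: j => // j /= jw. move=> jm.
have [g gi gE] := step_bijection n0 co wS wW rw cw.
have ge0 (p : 'I_(size w)) : entry r 1 <= entry r p.+1.
  by case: (posnP p) => [->//|p0]; rewrite ltW // entryS_lt // rw //; lia.
have [g' gK g'K] : bijective g by apply: injF_bij.
pose q := g' (Ordinal jw).
have gq : entry r j.+1 = entry r q.+1 + shift m n (nth letW w q) by rewrite -gE g'K.
have qW : nth letW w q = letW.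
  case: (boolP (nth letW w q)) => [qS|/negPf //].
  by exfalso; move: jm gq (ge0 q); rewrite qS /shift; lia.
have cq : count_mem letW (take q w) = j.
  rewrite count_take_ord.
  transitivity (\sum_(p < size w) (p < j : nat))%N.
    (* An S step ends at least at [entry r 1 + m], beyond index j, and W steps preserve order; so
       [g p < j] holds exactly at the W positions before q. *)
    rewrite [RHS](reindex_inj gi) /=; apply: eq_bigr => p _; congr nat_of_bool.
    rewrite -(@entryS_lt r (g p) j) ?rw // gE gq qW.
    case: (nth letW w p); rewrite /shift /= ?andbT ?andbF.
      by have := ge0 p; move: jm; rewrite gq qW /shift; lia.
    by rewrite -(@entryS_lt r p q) ?rw //; lia.
  (* The number of p < j is read off the word made of W only. *)
  have E := count_take_ord (nseq (size w) letW) letW j.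
  rewrite take_nseq ?(ltnW jw) // in E.
  move: E; rewrite count_nseq /= mul1n size_nseq => E; rewrite [RHS]E.
  by apply: eq_bigr => p _; rewrite nth_nseq if_same andbT.
have E := cat_take_drop q w; rewrite (drop_nth letW) // qW in E.
have pE : pos letW w j.+1 = q.+1.
  by rewrite -[w in pos _ w]E -cq pos_cat_cons size_takel // ltnW.
rewrite pE /= ltn_ord; split=> //; last by rewrite gq qW /shift; lia.
by rewrite -wW -E count_cat /= cq; lia.
Qed.

(* Dyck words, the numbers f_i and delta *)
Close Scope ring_scope.

Lemma count_negb0 (c : bool) (w : word) :
  count_mem (~~ c) w = 0 -> w = nseq (size w) c.
Proof. by elim: w => //= x w IH; case: x c IH => [] [] //= IH /IH {1}->. Qed.

Lemma pos_nseq_cat (a j : nat) (w : word) : 0 < j <= count_mem letW w ->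
  j + a <= pos letW (nseq a letS ++ w) j.
Proof.
move=> jw; have c0 : count_mem letW (nseq a letS) = 0 by rewrite count_nseq.
rewrite pos_catr ?count_cat c0 ?subn0 ?size_nseq // addnC leq_add2l.
have [u [v [_ cu ->]]] := pos_split jw.
by have := count_letters u; rewrite cu; lia.
Qed.

(** The prefix ending at the j-th W has j letters W, hence q - j letters S. Both cuts, after and
    before that W, are covered because delta is the position of a W if m = k n + 1 and one less than
    such a position if m = k n - 1. *)
Lemma pos_dyck (m n : nat) (sg : word) (j : nat) (q := pos letW sg j) :
  dyck m n sg -> 0 < j <= m ->
  [/\ j <= q, q <= m + n, n * j <= m * (q - j) &
      forall p, p = q \/ p = q.-1 -> count_mem letS (take p sg) = q - j].
Proof.
case=> cS cW D jm.
have [u [v [E cu qE]]] : exists u v, [/\ sg = u ++ letW :: v,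
    count_mem letW u = j.-1 & q = (size u).+1] by apply: pos_split; rewrite cW.
have cSu : count_mem letS u = q - j by have := count_letters u; lia.
have tq : take q sg = u ++ [:: letW].
  by rewrite E qE take_cat ltnNge leqnSn subSnn /= take0.
have tq1 : take q.-1 sg = u by rewrite E qE take_size_cat.
have su := count_letters u; have ss := count_letters sg.
have qs : q <= size sg by rewrite E size_cat /=; lia.
have := D q qs; rewrite tq !count_cat /= cu addn0 cSu // addn1 => H.
split; [lia|lia|by move: H; rewrite !addn0 prednK //; case/andP: jm|].
by move=> p [] ->; rewrite ?tq ?tq1 ?count_cat /= ?addn0 cSu.
Qed.

(** The Dyck condition forbids a leading W, and a leading run of n letters S would leave only W
    behind it. *)
Lemma dyck_prefix (m n : nat) (sg : word) : 0 < m -> 0 < n -> dyck m n sg ->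
  sg <> initial_word m n ->
  exists a v, sg = nseq a letS ++ letW :: v /\ 0 < a < n.
Proof.
move=> m0 n0 [cS cW D] ni.
have [u [v [E cu]]] : exists u v, sg = u ++ letW :: v /\ count_mem letW u = 0.
  by apply: count_split; rewrite cW.
have := count_negb0 (c := letS) cu; move: (size u) => a uE; subst u.
exists a, v; split=> //.
have sS : a + count_mem letS v = n by rewrite -cS E count_cat count_nseq /= mul1n.
have sW : (count_mem letW v).+1 = m by rewrite -cW E count_cat count_nseq.
have a0 : 0 < a.
  have := D a.+1; rewrite E size_cat size_nseq /= take_cat size_nseq.
  rewrite (ltnNge a.+1 a) leqnSn /= subSnn /= take0 !count_cat !count_nseq /= => /(_ ltac:(lia)).
  by case: (a) => //; lia.
rewrite a0 ltnNge; apply/negP => na; apply: ni.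
have an : a = n by lia.
have v0 : count_mem letS v = 0 by lia.
have := count_negb0 (c := letW) v0 => vE.
have := count_letters v; rewrite v0 => sv.
by rewrite E /initial_word an vE -sW; congr (_ ++ _); rewrite -sv.
Qed.

(** The f-th W sits at f plus the number of S before it, which is between a and n. The bound on k n
    keeps each index f_1, ..., f_(k-1) at most m, so that the W in question exists. *)
Lemma fussi_f_bounds (m n k a : nat) (sg v : word) : dyck m n sg ->
  sg = nseq a letS ++ letW :: v -> a < n -> k * n <= m.+1 ->
  forall i, 0 < i <= k -> 1 + i * a <= fussi_f sg i <= i * n.
Proof.
move=> D E an kn; have [cS cW _] := D; elim=> // -[|i] IH ik.
  have -> : fussi_f sg 1 = a.+1; last by lia.
  rewrite /fussi_f /= E -[1]/((count_mem letW (nseq 0 letS)).+1).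
  by have := pos_cat_cons letW (nseq a letS) v; rewrite count_nseq size_nseq.
have := IH ltac:(lia); set f := fussi_f sg i.+1 => fb.
have fm : 0 < f <= m by nia.
have -> : fussi_f sg i.+2 = pos letW sg f by [].
have [h1 h2 h3 h4] := pos_dyck D fm.
have := pos_nseq_cat a (w := letW :: v) (j := f).
rewrite -E; have -> : count_mem letW (letW :: v) = m.
  by rewrite -cW E count_cat count_nseq.
move=> /(_ fm) h5; have h6 := h4 _ (or_introl erefl).
have h7 : count_mem letS (take (pos letW sg f) sg) <= n.
  by rewrite -cS -[in leqRHS](cat_take_drop (pos letW sg f) sg) count_cat leq_addr.
by nia.
Qed.

Lemma fussi_sE (a : nat) (v : word) : fussi_s (nseq a letS ++ letW :: v) = a.+1.
Proof.
have := pos_cat_cons letW (nseq a letS) v.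
by rewrite count_nseq size_nseq.
Qed.

(* The first a letters are S, so the second clause says that the W moved from
   position a + 1 to delta passes at least one S. *)
Lemma fussi_delta_spec (m n k a : nat) (sg v : word)
    (d := fussi_delta m n k sg) :
  0 < m -> 0 < n -> 0 < k -> m = k * n + 1 \/ m = k * n - 1 -> dyck m n sg ->
  sg = nseq a letS ++ letW :: v -> 0 < a < n ->
  [/\ d <= m + n, a < count_mem letS (take d sg) &
      [/\ m = k * n + 1, 0 < fussi_f sg k <= m & d = fussi_f sg k.+1] \/
      [/\ m.+1 = k * n, 2 < fussi_f sg k <= m.+1, fussi_f sg k <= d &
          d.+1 = pos letW sg (fussi_f sg k).-1]].
Proof.
move=> m0 n0 k0 hm D E an.
have := fussi_f_bounds (k := k) D E ltac:(lia) ltac:(nia) (i := k) ltac:(lia).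
rewrite /d /fussi_delta; case: eqP => mk.
  rewrite [fussi_f sg k.+1]iterS -/(fussi_f sg k); set f := fussi_f sg k => fb.
  have fm : 0 < f <= m by nia.
  have [h1 h2 h3 h4] := pos_dyck D fm.
  rewrite (h4 _ (or_introl erefl)); split=> //; last by left.
  (* Here n f <= m x and f >= 1 + k a; if x <= a, then n + k n a <= k n a + a, against a < n. *)
  by move: h3; set x := _ - f; nia.
have {mk}hm : m.+1 = k * n by lia.
set f := fussi_f sg k => fb; rewrite subn1.
have fm : 0 < f.-1 <= m by nia.
have [h1 h2 h3 h4] := pos_dyck D fm.
rewrite subn1 (h4 _ (or_intror erefl)).
(* Now f - 1 >= k a, and x <= a would give k n a <= (k n - 1) a, against a > 0. *)
have ax : a < pos letW sg f.-1 - f.-1.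
  by move: h3; set x := pos _ _ _ - _; nia.
(* The first W, at s = a + 1, has only a letters S before it. *)
have f2 : f.-1 <> 1.
  move=> f1; move: ax; rewrite f1 -[pos _ _ _]/(fussi_s sg) E fussi_sE; lia.
by split; [lia | lia | right; split; lia].
Qed.

(** * Moving the W from s to delta *)

Lemma pos_moved (a j : nat) (B C : word) (sg := nseq a letS ++ letW :: B ++ C) :
  0 < j -> j < count_mem letW sg -> pos letW sg j.+1 <= a.+1 + size B ->
  pos letW (nseq a letS ++ B ++ letW :: C) j = (pos letW sg j.+1).-1.
Proof.
have c0 : count_mem letW (nseq a letS) = 0 by rewrite count_nseq.
rewrite /sg !count_cat c0 /= add1n add0n ltnS => j0 jw.
rewrite pos_catr ?c0 ?subn0 ?count_cat ?size_nseq ?c0 ?add0n /= ?add1n ?ltnS //.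
(* The removed W, as a one-letter word, accounts for one index and one position. *)
rewrite -cat1s pos_catr /= ?count_cat ?add1n ?subSS ?subn0 ?ltnS ?j0 //; last first.
  by rewrite -count_cat.
case: (leqP j (count_mem letW B)) => jB.
  rewrite pos_catl // => _; rewrite pos_catr ?count_cat c0 ?subn0 ?size_nseq /=.
    by rewrite pos_catl // addnS.
  by rewrite j0 add0n (leq_trans jB) ?leq_addr.
(* Such a W lies in C, past delta, contrary to the hypothesis. *)
rewrite count_cat in jw; rewrite [pos _ (B ++ C) _]pos_catr ?count_cat ?jB //.
have jC : 0 < j - count_mem letW B <= count_mem letW C.
  by rewrite subn_gt0 jB leq_subLR.
by have [u [v [_ _ ->]]] := pos_split jC; lia.
Qed.

Lemma pos_inserted (a : nat) (B C : word) :
  pos letW (nseq a letS ++ B ++ letW :: C) (count_mem letW B).+1 =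
  a.+1 + size B.
Proof.
rewrite catA -[count_mem _ B]add0n -[0](_ : count_mem letW (nseq a letS) = 0).
  by rewrite -count_cat pos_cat_cons size_cat size_nseq.
by rewrite count_nseq.
Qed.

Lemma count_moved (a : nat) (b : bool) (B C : word) :
  count_mem b (nseq a letS ++ B ++ letW :: C) =
  count_mem b (nseq a letS ++ letW :: B ++ C).
Proof. by apply/permP; rewrite perm_cat2l -cat1s perm_catCA. Qed.

(** * Ranks at the positions f_i - 1 and delta *)

Open Scope ring_scope.

Lemma entry_lt (r : seq int) (i j : nat) : sorted <%R r -> (0 < i <= size r)%N ->
  (0 < j <= size r)%N -> (entry r i < entry r j) = (i < j)%N.
Proof.
by case: i j => // i [|j] // sr /= ir jr; rewrite entryS_lt.
Qed.

Lemma entry_mem (r : seq int) (x : int) : x \in r ->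
  exists2 i, (0 < i <= size r)%N & entry r i = x.
Proof. by move=> /(nthP 0)[i ir <-]; exists i.+1. Qed.

Lemma entry_in (r : seq int) (i : nat) : (0 < i <= size r)%N -> entry r i \in r.
Proof. by case: i => // i ir; apply: mem_nth. Qed.

Lemma entry1 (m n : nat) (r : seq int) : rank_seq m n r -> entry r 1 = 0.
Proof.
case=> _ sr /allP r0 /[dup] r1 /entry_mem[i ir iE]; apply/eqP; rewrite eq_le.
rewrite r0 ?andbT; last by apply: entry_in; lia.
by rewrite -[in leRHS]iE leNgt entry_lt //; lia.
Qed.

Section Step.

Variables (m n k a : nat) (B C : word) (r : seq int).
Let sg := nseq a letS ++ letW :: B ++ C.
Let u := nseq a letS ++ B ++ letW :: C.
Hypotheses (m0 : (0 < m)%N) (n0 : (0 < n)%N) (k0 : (0 < k)%N)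
  (mk : m = (k * n + 1)%N \/ m = (k * n - 1)%N) (co : coprime m n)
  (an : (0 < a < n)%N) (D : dyck m n sg)
  (dE : fussi_delta m n k sg = (a.+1 + size B)%N)
  (rr : rank_seq m n r) (cr : closed_under m n u r).

Let uS : count_mem letS u = n.
Proof. by rewrite /u count_moved; case: D. Qed.

Let uW : count_mem letW u = m.
Proof. by rewrite /u count_moved; case: D. Qed.

Let su : size u = (m + n)%N.
Proof. by rewrite -count_letters uS uW addnC. Qed.

Let ru : size r = size u.
Proof. by rewrite su; case: rr. Qed.

Let sr : sorted <%R r.
Proof. by case: rr. Qed.

Let posW (j : nat) : (0 < j <= m + n)%N -> entry r j < m%:Z ->
  [/\ (j <= m)%N, (0 < pos letW u j <= m + n)%N &
      entry r (pos letW u j) = entry r j + n%:Z].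
Proof.
move=> jm rj; rewrite -su; apply: rank_posW => //; first by rewrite su.
by rewrite (entry1 rr) add0r.
Qed.

(** The first W of [u] comes after the a leading letters S and carries 0 + n, so position a carries
    less. Thus the shift t is positive. *)
Lemma entry_lt_n : 0 <= entry r a < n%:Z.
Proof.
apply/andP; split.
  by case: rr => rs _ /allP + _; apply; apply: entry_in; lia.
have [_ pu pE] := @posW 1 ltac:(lia) ltac:(rewrite (entry1 rr); lia).
move: pE; rewrite (entry1 rr) add0r => <-; rewrite entry_lt ?ru ?su; try lia.
have := @pos_nseq_cat a 1 (B ++ letW :: C).
by move=> /(_ ltac:(by rewrite /= count_cat /= addnS)); rewrite -/u; lia.
Qed.

(* f_i is the position of the multiple i n in the new sequence. *)
Lemma entry_fussi_f (i : nat) : (i <= k)%N -> (i * n <= m)%N ->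
  (fussi_f sg i.+1 <= a.+1 + size B)%N ->
  entry r (fussi_f sg i.+1).-1 = entry r a + (i * n)%N%:Z.
Proof.
have fb := fussi_f_bounds (k := k) D erefl ltac:(lia) ltac:(nia).
elim: i => [|i IH] ik im; first by rewrite -/(fussi_s sg) fussi_sE addr0.
have := fb i.+1 ltac:(lia); set f := fussi_f sg i.+1 in IH *.
rewrite [fussi_f sg i.+2]iterS -/(fussi_f sg i.+1) -/f => fi fd.
have fm : (0 < f <= m)%N by nia.
have pf : (f + a <= pos letW sg f)%N.
  apply: pos_nseq_cat; move: fm; have [_ <- _] := D.
  by rewrite {1}/sg count_cat count_nseq.
have := IH ltac:(lia) ltac:(nia) ltac:(lia) => fE.
(* By [entry_lt_n] this rank is below (i + 1) n <= m, where [posW] applies. *)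
have [_ _] := @posW f.-1 ltac:(nia) ltac:(rewrite fE; have := entry_lt_n; nia).
have f2 : (1 < f)%N by nia.
(* W number f of [sg] is W number f - 1 of [u], one position earlier. *)
rewrite /u pos_moved -/sg ?prednK //; try lia.
  by have [_ -> _] := D; case/andP: fm.

Qed.

(** With c the rank at position a, the position e of c + m is pinned down by comparing ranks next to
    delta. *)
Lemma entry_fussi_delta :
  entry r (a.+1 + size B) = entry r a + m%:Z.
Proof.
have [dN _ d2] := fussi_delta_spec m0 n0 k0 mk D erefl an.
rewrite dE in dN d2; set d := (a.+1 + size B)%N in dN d2 *.
(* Letter a of [u] is an S, so c + m is in the set. *)
have [e er eE] : exists2 e, (0 < e <= size r)%N & entry r e = entry r a + m%:Z.
  apply: entry_mem; have := cr (p := a.-1); rewrite su prednK; last by lia.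
  by rewrite /u nth_cat size_nseq prednK ?leqnn ?nth_nseq ?prednK ?leqnn; try lia; apply; lia.
rewrite ru su in er; have c0 := entry_lt_n.
have elt i j : (0 < i <= m + n)%N -> (0 < j <= m + n)%N ->
  (entry r i < entry r j) = (i < j)%N by move=> *; rewrite entry_lt ?ru ?su.
suff -> : d = e by [].
case: d2 => [[mE fk dk]|[mE fk fd dk]].
  (* Position delta - 1 carries c + k n = c + m - 1, so the next integer c + m comes right after
     it. *)
  have := entry_fussi_f (i := k) ltac:(lia) ltac:(lia) ltac:(lia).
  rewrite -dk -/d => h.
  have h1 := elt d.-1 e ltac:(lia) ltac:(lia).
  have h2 := elt d.-1 d ltac:(lia) ltac:(lia).
  have h3 := elt d e ltac:(lia) ltac:(lia).
  lia.
set f := fussi_f sg k in fk fd dk.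
have hk : k = k.-1.+1 by lia.
have hf := entry_fussi_f (i := k.-1) ltac:(lia) ltac:(nia) ltac:(rewrite -hk; lia).
rewrite -hk -/f in hf.
have f1 := elt f.-2 f.-1 ltac:(lia) ltac:(lia).
(* The rank at f - 2 is at most c + (k - 1) n - 1 = c + m - n, which is below m as c < n. *)
have [g1 g2] := @posW f.-2 ltac:(lia) ltac:(nia).
(* B has f - 3 letters W, so the inserted W is number f - 2; its rank, at delta, is therefore at
   most c + m. *)
have fdE : pos letW u f.-2 = d.
  rewrite -[RHS](pos_inserted a B C); congr pos.
  have := pos_dyck D (j := f.-1) ltac:(lia); rewrite -dk.
  move=> [_ _ _ /(_ d (or_intror erefl))].
  have -> : take d sg = nseq a letS ++ letW :: B.
    by rewrite /sg -cat_cons catA take_size_cat // size_cat size_nseq addnS.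
  rewrite count_cat count_nseq /= => hS.
  by have /= := count_letters B; have : d = (a.+1 + size B)%N by []; lia.
rewrite fdE => h.
(* Letter delta + 1 is W number f - 1 of [sg], and it keeps its place in [u]. *)
have [x [y [sE _ px]]] : exists x y, [/\ sg = x ++ letW :: y,
    count_mem letW x = f.-2 & pos letW sg f.-1 = (size x).+1].
  by apply: pos_split; have [_ -> _] := D; lia.
have dx : size x = d by lia.
have dm : (d < m + n)%N by have [_ q _ _] := pos_dyck D (j := f.-1) ltac:(lia); lia.
have uW' : nth letW u d = letW.
  transitivity (nth letW sg d); last by rewrite sE -dx nth_cat ltnn subnn.
  by rewrite /u /sg -cat_rcons -cat_cons !catA !nth_cat !size_cat size_rcons
    !size_nseq /= !addnS ltnn.
(* This element exceeds the rank at f - 2, so it is at least the rank at f - 1. Hence the rank at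
   delta + 1 is at least c + k n = c + m + 1, and e <= delta. *)
have /entry_mem[j jr jE] : entry r d.+1 - n%:Z \in r.
  by have := cr (p := d); rewrite su uW' => /(_ dm).
rewrite ru su in jr.
have e1 := elt f.-2 j ltac:(lia) jr.
have e2 := elt j f.-1 jr ltac:(lia).
have e3 := elt d d.+1 ltac:(lia) ltac:(lia).
have e4 := elt e d.+1 ltac:(lia) ltac:(lia).
have e5 := elt e d ltac:(lia) ltac:(lia).
have e6 := elt d e ltac:(lia) ltac:(lia).
nia.
Qed.
End Step.

(** * Rerouting the steps through 0 *)

Lemma closed_underP (m n : nat) (w : word) (r : seq int) : size r = size w ->
  closed_under m n w r <->
  forall b x, (b, x) \in zip w r -> x + shift m n b \in r.
Proof.
move=> rw; split=> [cw b x /(nthP (letW, 0))[p] | cw p pw].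
  by rewrite size_zip rw minnn => pw; rewrite nth_zip // => -[<- <-]; apply: cw.
apply: cw; apply/(nthP (letW, 0)); exists p; first by rewrite size_zip rw minnn.
by rewrite nth_zip.
Qed.

(** Injectivity of the step map in terms of letter-rank pairs, a form free of positions and so
    convenient when blocks are rearranged. *)
Lemma closed_under_inj (m n : nat) (w : word) (r : seq int)
    (b b' : bool) (x x' : int) :
  (0 < n)%N -> coprime m n -> count_mem letS w = n -> count_mem letW w = m ->
  size r = size w -> uniq r -> closed_under m n w r ->
  (b, x) \in zip w r -> (b', x') \in zip w r ->
  x + shift m n b = x' + shift m n b' -> x = x'.
Proof.
move=> n0 co wS wW rw ur cw /(nthP (letW, 0))[p pw pE] /(nthP (letW, 0))[q qw qE].
rewrite size_zip rw minnn in pw qw; move: pE qE; rewrite !nth_zip //.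
move=> -[<- <-] -[<- <-] E.
have [g gi gE] := step_bijection n0 co wS wW rw cw.
have gs i : (g i < size r)%N by rewrite rw.
suff /(congr1 val) /= -> : Ordinal pw = Ordinal qw by [].
apply: gi; apply: val_inj; apply/eqP; rewrite -(nth_uniq 0 _ _ ur) ?gs //.
by apply/eqP; rewrite -![nth 0 r _]/(entry r _.+1) !gE.
Qed.

(** All letter-rank pairs other than those of c and c + m survive the shift. Their steps avoid the
    deleted c + m because, by injectivity, only c steps there. *)
Lemma closed_step (m n : nat) (A B C : word) (X Y Z : seq int) (c : int)
    (w := A ++ letS :: B ++ letW :: C) (r := X ++ c :: Y ++ (c + m%:Z) :: Z) :
  (0 < n)%N -> coprime m n -> count_mem letS w = n -> count_mem letW w = m ->
  size A = size X -> size B = size Y -> size C = size Z ->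
  uniq r -> closed_under m n w r ->
  closed_under m n (letS :: A ++ letW :: B ++ C)
    (0 :: [seq x + (n%:Z - c) | x <- X ++ c :: Y ++ Z]).
Proof.
move=> n0 co wS wW AX BY CZ ur cw.
have rw : size r = size w
  by rewrite /r /w !size_cat /= !size_cat /= AX BY CZ.
have inj := closed_under_inj n0 co wS wW rw ur cw.
have cwz : forall b x, (b, x) \in zip w r -> x + shift m n b \in r by apply/closed_underP.
set r' := 0 :: _.
have zE : zip w r = zip A X ++ (letS, c) :: zip B Y ++ (letW, c + m%:Z) :: zip C Z.
  by rewrite /w /r zip_cat // /= zip_cat.
have mc : (letS, c) \in zip w r by rewrite zE mem_cat inE eqxx orbT.
have me : (letW, c + m%:Z) \in zip w r.
  by rewrite zE mem_cat inE mem_cat inE eqxx !orbT.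
have keep y : y \in r -> y <> c + m%:Z -> y + (n%:Z - c) \in r'.
  move=> yr ye; rewrite inE; apply/orP; right; apply/map_f; move: yr.
  by rewrite !(mem_cat, inE) => /or4P[->|->|->|/predU1P[]// ->]; rewrite ?orbT.
have old b x : (b, x) \in zip w r -> x <> c -> x + (n%:Z - c) + shift m n b \in r'.
  move=> bx xc; rewrite addrAC; apply: keep; first exact: cwz.
  by move=> E; apply: xc; apply: inj bx mc _.
have cn : c \notin X ++ Y ++ Z.
  move: ur; rewrite /r -cat1s uniq_catCA /= => /andP[+ _].
  by rewrite !mem_cat inE !negb_or => /and3P[-> -> /andP[_ ->]].
apply/closed_underP; first by rewrite /= size_map !size_cat /= !size_cat AX BY CZ.
(* The three unchanged blocks avoid c and are treated alike. *)
have mz (D : word) (V : seq int) b x : {subset zip D V <= zip w r} ->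
    {subset V <= X ++ Y ++ Z} ->
    (b, x) \in zip D [seq y + (n%:Z - c) | y <- V] -> x + shift m n b \in r'.
  move=> zs Vs; elim: D V zs Vs => [|d D IH] [|v V] // zs Vs /=; rewrite inE.
  case/predU1P => [[-> ->]|]; last first.
    by apply: IH => z zV; [apply: zs | apply: Vs]; rewrite inE zV orbT.
  apply: old; first by apply: zs; rewrite mem_head.
  by move=> vc; move: cn; rewrite -vc Vs ?mem_head.
move=> b x; rewrite {1}/r' /= inE => /predU1P[[-> ->]|].
  (* The old W step from c + m reached c + m - n, which the shift sends to m. *)
  rewrite /= add0r (_ : m%:Z = (c + m%:Z - n%:Z) + (n%:Z - c)); last by lia.
  by apply: keep; [apply: (cwz letW) | lia].
rewrite !map_cat /= map_cat zip_cat ?size_map //= zip_cat ?size_map //.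
rewrite mem_cat inE mem_cat => /or4P[|/eqP[-> ->]||].
- by apply: (mz A X) => z zi; rewrite ?zE !mem_cat ?zi.
- by rewrite /= (_ : c + _ + _ = 0) ?mem_head //; lia.
- by apply: (mz B Y) => z zi; rewrite ?zE !(mem_cat, inE) ?zi ?orbT.
- by apply: (mz C Z) => z zi; rewrite ?zE !(mem_cat, inE) ?zi ?orbT.
Qed.

(** Since c < n, the shifted entries are positive, so prepending 0 keeps the list strictly sorted;
    two strictly sorted lists with the same members agree. *)
Lemma fussi_outE (m n s : nat) (X Y Z : seq int) (c : int)
    (r := X ++ c :: Y ++ (c + m%:Z) :: Z) :
  c < n%:Z -> sorted <%R r -> all (fun x => 0 <= x) r -> entry r s.-1 = c ->
  let r' := 0 :: [seq x + (n%:Z - c) | x <- X ++ c :: Y ++ Z] in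
  [/\ fussi_out m n s r = r', sorted <%R r' & all (fun x => 0 <= x) r'].
Proof.
move=> cn sr r0 sc r'.
have sub : subseq (X ++ c :: Y ++ Z) r.
  by rewrite /r cat_subseq //= eqxx cat_subseq // -cat1s suffix_subseq.
have sXYZ := subseq_sorted lt_trans sub sr.
have pos' : all (fun x => 0 < x) (behead r').
  rewrite all_map; apply/allP => x /(mem_subseq sub) /(allP r0) /= x0; lia.
have sr' : sorted <%R r'.
  rewrite /= (path_sortedE lt_trans) pos' /= sorted_map.
  by apply: sub_sorted sXYZ => x y; rewrite /= ltrD2r.
split=> //; last first.
  by apply: sub_all pos' => x; apply: ltW.
rewrite /fussi_out sc; apply: lt_sorted_eq => // [|y].
  by rewrite sort_lt_sorted undup_uniq.
rewrite mem_sort mem_undup !inE mem_filter; congr (_ || _).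
(* m + n is the image of c + m, which occurs once in r, so the filter removes exactly that entry. *)
have -> : (m + n)%N%:Z = (c + m%:Z) + (n%:Z - c) by lia.
have addI := @addIr _ (n%:Z - c).
have [x ->] : exists x, y = x + (n%:Z - c) by exists (y - (n%:Z - c)); rewrite subrK.
have mm (V : seq int) : (x + (n%:Z - c) \in [seq z + (n%:Z - c) | z <- V]) = (x \in V).
  exact: (mem_map addI).
rewrite (inj_eq addI) !mm; have := sorted_uniq lt_trans ltxx sr.
rewrite /r -cat_cons catA -(cat1s (c + m%:Z)) uniq_catCA /= => /andP[].
rewrite -!catA /= !(mem_cat, inE); case: (eqVneq x (c + m%:Z)) => [->|//].
by move=> /negPf->.
Qed.

(* The recursion: descent, invariants and conclusion *)
Close Scope ring_scope.

Lemma fussi_leftE (m n k a : nat) (B C : word)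
    (sg := nseq a letS ++ letW :: B ++ C) :
  fussi_delta m n k sg = a.+1 + size B ->
  fussi_left m n k sg = nseq a letS ++ B ++ letW :: C.
Proof.
rewrite /fussi_left => ->; rewrite /insert_after.
have -> : sg = (nseq a letS ++ letW :: B) ++ C by rewrite /sg -catA.
have sz : size (nseq a letS ++ letW :: B) = a.+1 + size B.
  by rewrite size_cat size_nseq addnS.
rewrite take_size_cat // drop_size_cat // -!catA cat_cons fussi_sE /remove_at /=.
rewrite take_size_cat ?size_nseq // -(cat_rcons letW (nseq a _)).
by rewrite drop_size_cat // size_rcons size_nseq.
Qed.

(** The prefix up to delta has more than a letters S. Hence delta > a, and the S beyond the leading
    run lies in B. *)
Lemma fussi_shape (m n k : nat) (sg : word) : 0 < m -> 0 < n -> 0 < k ->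
  m = k * n + 1 \/ m = k * n - 1 -> dyck m n sg -> sg <> initial_word m n ->
  exists a B C, [/\ sg = nseq a letS ++ letW :: B ++ C, 0 < a < n,
    fussi_delta m n k sg = a.+1 + size B & 0 < count_mem letS B].
Proof.
move=> m0 n0 k0 mk D ni.
have [a [v [E an]]] := dyck_prefix m0 n0 D ni.
have [dN dS _] := fussi_delta_spec m0 n0 k0 mk D E an.
set d := fussi_delta m n k sg in dN dS.
have ad : a < d.
  rewrite ltnNge; apply/negP => da; move: dS.
  by rewrite E takel_cat ?size_nseq // take_nseq // count_nseq /=; lia.
have [cS cW _] := D.
have sv : a.+1 + size v = m + n.
  by have := count_letters sg; rewrite cS cW E size_cat size_nseq /=; lia.
exists a, (take (d - a.+1) v), (drop (d - a.+1) v); rewrite cat_take_drop.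
have sB : size (take (d - a.+1) v) = d - a.+1 by rewrite size_takel //; lia.
split=> //; first by rewrite sB; lia.
move: dS; rewrite E take_cat size_nseq (ltnNge d a) (ltnW ad) /= -[d - a]prednK ?subn_gt0 //.
by rewrite /= -subnS count_cat count_nseq /=; lia.
Qed.

Lemma take_size_add (T : Type) (s t : seq T) (i : nat) :
  take (size s + i) (s ++ t) = s ++ take i t.
Proof. by rewrite take_cat ltnNge leq_addr addKn. Qed.

(** A cut inside B is compared with the old cut one letter further, which has the same S and one
    more W; at all other cuts the counts agree. *)
Lemma dyck_moved (m n a : nat) (B C : word) :
  dyck m n (nseq a letS ++ letW :: B ++ C) ->
  dyck m n (nseq a letS ++ B ++ letW :: C).
Proof.
case=> cS cW D; split; rewrite ?count_moved // => p.
have ta i w : take (a + i) (nseq a letS ++ w) = nseq a letS ++ take i w.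
  by rewrite -{1}(size_nseq a letS) take_size_add.
have D' q : q <= a + (size B + size C).+1 -> _ := fun qN => D q ltac:(by
  rewrite !size_cat size_nseq /= !size_cat).
rewrite !size_cat size_nseq /= addnS => pN; case: (leqP p a) => pa.
  by have := D' p ltac:(lia); rewrite !takel_cat ?size_nseq.
case: (leqP p (a + size B)) => pB.
  have -> : p = a + (p - a) by lia.
  have := D' (a + (p - a).+1) ltac:(lia).
  rewrite !ta /= !takel_cat ?leq_subLR // !count_cat /= => h.
  by apply: leq_trans h; rewrite leq_mul2l leq_add2l leq_addl orbT.
have -> : p = a + (size B + (p - a - size B).-1.+1) by lia.
set q := _.-1; have := D' (a + (size B + q).+1) ltac:(rewrite /q; lia).
 by rewrite !ta /= !take_size_add !count_cat /= !count_cat !add0n (addnCA 1).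
Qed.

(** The termination measure: moving a W to the right across B lowers it by the number of S in B. *)
Fixpoint inversions (w : word) : nat :=
  if w is x :: w' then (if x then 0 else count_mem letS w') + inversions w' else 0.

Lemma inversions_moved (a : nat) (B C : word) :
  inversions (nseq a letS ++ letW :: B ++ C) =
  count_mem letS B + inversions (nseq a letS ++ B ++ letW :: C).
Proof.
elim: a => //=; rewrite count_cat.
elim: B => [|[] B IH] /=; rewrite ?count_cat /=; lia.
Qed.

Lemma initial_compatible (m n : nat) : 0 < n ->
  rank_seq m n [seq Posz i | i <- iota 0 (m + n)] /\
  compatible m n (initial_word m n) [seq Posz i | i <- iota 0 (m + n)].
Proof.
move=> n0; have mr (x : nat) :
    x < m + n -> Posz x \in [seq Posz i | i <- iota 0 (m + n)].
  by move=> xN; rewrite map_f // mem_iota.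
split.
  split; rewrite ?size_map ?size_iota //; last by apply: (mr 0); lia.
    by rewrite sorted_map; apply: sub_sorted (iota_ltn_sorted 0 (m + n)).
  by rewrite all_map; apply/allP.
have cS : count_mem letS (initial_word m n) = n.
  by rewrite /initial_word count_cat !count_nseq /=; lia.
have cW : count_mem letW (initial_word m n) = m.
  by rewrite /initial_word count_cat !count_nseq /=; lia.
apply/compatibleP => // p; rewrite -count_letters cS cW => pN.
rewrite /entry (nth_map 0) ?size_iota ?nth_iota /= ?add0n; try lia.
rewrite /initial_word nth_cat size_nseq !nth_nseq; case: ltnP => pn /=.
  by apply: (mr (p + m)); lia.
rewrite if_same /=; have -> : (p%:Z - n%:Z)%R = Posz (p - n) by lia.
by apply: mr; lia.
Qed.

Lemma rank_split (r : seq int) (a b : nat) : 0 < a -> a.+1 + b <= size r ->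
  exists X Y Z, [/\ r = X ++ entry r a :: Y ++ entry r (a.+1 + b) :: Z,
    size X = a.-1 & size Y = b].
Proof.
case: a => // a _ ab; exists (take a r), (take b (drop a.+1 r)), (drop (a.+2 + b) r).
rewrite !size_takel ?size_drop; try lia; split=> //.
rewrite -{1}(cat_take_drop a r) (drop_nth 0%R) ?(leq_trans _ ab) //; last by lia.
congr (_ ++ _ :: _); rewrite -{1}(cat_take_drop b (drop a.+1 r)) drop_drop.
have -> : b + a.+1 = a.+1 + b by lia.
by rewrite (drop_nth 0%R (n := a.+1 + b)) //; lia.
Qed.

Lemma step_compatible (m n k : nat) (sg : word) (rL : seq int) :
  0 < m -> 0 < n -> coprime m n -> 0 < k ->
  m = k * n + 1 \/ m = k * n - 1 -> dyck m n sg -> sg <> initial_word m n ->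
  rank_seq m n rL -> compatible m n (fussi_left m n k sg) rL ->
  rank_seq m n (fussi_out m n (fussi_s sg) rL) /\
  compatible m n sg (fussi_out m n (fussi_s sg) rL).
Proof.
move=> m0 n0 co k0 mk D ni rr.
have [a [B [C [E an dE _]]]] := fussi_shape m0 n0 k0 mk D ni; subst sg.
rewrite fussi_leftE // fussi_sE; have [cS cW _] := D.
set u := _ ++ B ++ _; have uS : count_mem letS u = n by rewrite count_moved.
have uW : count_mem letW u = m by rewrite count_moved.
move=> /compatibleP -/(_ uS uW) cr.
have eE := entry_fussi_delta m0 n0 k0 mk co an D dE rr cr.
have ca := entry_lt_n m0 n0 k0 mk co an D dE rr cr.
have [rs sr r0 _] := rr.
have uN : size u = m + n by rewrite -count_letters uS uW addnC.
have [X [Y [Z [rE sX sY]]]] : exists X Y Z,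
  [/\ rL = X ++ entry rL a :: Y ++ entry rL (a.+1 + size B) :: Z,
    size X = a.-1 & size Y = size B].
  apply: rank_split; first by lia.
  by rewrite rs -uN /u !size_cat size_nseq /=; lia.
rewrite eE in rE; set c := entry rL a in ca rE.
have aE : a = a.-1.+1 by lia.
(* The S at position a, the one carrying c, is split off the leading run. *)
have wE V : nseq a letS ++ V = nseq a.-1 letS ++ letS :: V.
  by rewrite {1}aE; elim: (a.-1) => //= b ->.
have sZ : size C = size Z.
  move: uN; rewrite -rs rE /u !size_cat /= !size_cat size_nseq /= sX sY; lia.
have rc := fussi_outE (m := m) (s := a.+1) (X := X) (Y := Y) (Z := Z) (c := c) (n := n).
rewrite -rE in rc; have [||||outE so o0] := rc _ _ _ _ => //; first by case/andP: ca.
rewrite outE; split.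
  split; rewrite ?mem_head //= size_map -rs rE !size_cat /= !size_cat /=; lia.
apply/compatibleP => //; rewrite {1}aE /=.
rewrite rE in sr cr; rewrite /u wE in cr uS uW.
apply: closed_step cr => //; rewrite ?size_nseq //.
exact: (sorted_uniq lt_trans ltxx sr).
Qed.

Theorem mainTheorem3 (m n k : nat)
    (hm : 0 < m) (hn : 0 < n) (hmn : coprime m n) (hk : 1 <= k)
    (hmk : m = k * n + 1 \/ m = k * n - 1)
    (sg : word) (hsg : dyck m n sg) :
  (exists r : seq int, FussiPhi m n k sg r) /\
  (forall r : seq int, FussiPhi m n k sg r ->
     rank_seq m n r /\ compatible m n sg r).
Proof.
split; last first.
  (* Correctness of every output is by induction on the run. *)
  move=> r; elim=> [_|w rL D ni _ _ [rr cr]]; first exact: initial_compatible.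
  exact: (step_compatible hm hn hmn hk hmk D ni rr cr).
(* A run exists by induction on the inversions, which drop strictly because B contains an S. *)
have [N] := ubnP (inversions sg); elim: N sg hsg => // N IH sg hsg.
rewrite ltnS => iN; case: (eqVneq sg (initial_word m n)) => [E|/eqP ni].
  by rewrite E in hsg *; eexists; apply: FussiPhi_stop.
have [a [B [C [E an dE BS]]]] := fussi_shape hm hn hk hmk hsg ni.
have lE : fussi_left m n k sg = nseq a letS ++ B ++ letW :: C.
  by rewrite E fussi_leftE // -E.
have [r Hr] : exists r, FussiPhi m n k (fussi_left m n k sg) r.
  rewrite lE; apply: IH; first by apply: dyck_moved; rewrite -E.
  by apply: leq_trans iN; rewrite E inversions_moved -addn1 addnC leq_add2r.
eexists; apply: FussiPhi_step Hr => //.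
by rewrite dE E fussi_sE; lia.
Qed.
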